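(* Let $A$ be a set with $|A| \le \aleph_0$, let $m \in \mathbb{N}$, and let $C$ be a clone on $A$ with quasigroup operations such that $|C^{[m]}| \le \aleph_0$. If $\bigcap_{k \in \mathbb{N}} \mathrm{Lo}_k(C^{[m]}) = C^{[m]}$, then there exists $n \in \mathbb{N}$ such that $\mathrm{Lo}_n(C^{[m]}) = C^{[m]}$.
   Context: A clone on $A$ is a set of finitary operations on $A$ containing all projections and closed under composition; $C^{[m]}$ denotes the set of $m$-ary operations in $C$. $C$ is a clone with quasigroup operations if there are binary operations $\cdot, \backslash, / \in C$ such that $(A; \cdot, \backslash, /)$ is a quasigroup. For sets $A, B$, $F \subseteq A^B$ and $k \in \mathbb{N}$, $\mathrm{Lo}_k F$ is the set of all functions $f: B \to A$ such that for every subset $S \subseteq B$ with at most $k$ elements there is $g \in F$ with $g|_S = f|_S$ (here $B = A^m$). *)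

(* Defs.v *)
From mathcomp Require Import all_boot.
From mathcomp Require Import boolp classical_sets functions cardinality.

Set Implicit Arguments.
Unset Strict Implicit.
Unset Printing Implicit Defensive.

Local Open Scope classical_set_scope.

Definition operation (A : Type) (n : nat) : Type := n.-tuple A -> A.

Definition proj_op (A : Type) (n : nat) (i : 'I_n) : operation A n :=
  fun t => tnth t i.

Definition comp_op (A : Type) (n m : nat) (f : operation A n)
    (g : 'I_n -> operation A m) : operation A m :=
  fun t => f [tuple g i t | i < n].

(* [C n] is the set C^[n] of n-ary operations.  Arity 0 is allowed, but [C 0]
   may be empty, so a clone in the sense that admits only positive arities is
   covered by taking [C 0 = set0]. *)
Definition is_clone (A : Type) (C : forall n, set (operation A n)) : Prop :=
  (forall n (i : 'I_n), C n (@proj_op A n i)) /\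
  (forall n m (f : operation A n) (g : 'I_n -> operation A m),
     C n f -> (forall i, C m (g i)) -> C m (comp_op f g)).

Definition is_quasigroup (A : Type) (mul ldiv rdiv : A -> A -> A) : Prop :=
  [/\ forall x y, mul x (ldiv x y) = y,
      forall x y, ldiv x (mul x y) = y,
      forall x y, mul (rdiv y x) x = y
    & forall x y, rdiv (mul y x) x = y].

Definition op2 (A : Type) (f : operation A 2) : A -> A -> A :=
  fun x y => f [tuple x; y].

Definition has_quasigroup_operations (A : Type)
    (C : forall n, set (operation A n)) : Prop :=
  exists mul ldiv rdiv : operation A 2,
    [/\ C 2 mul, C 2 ldiv, C 2 rdiv
      & is_quasigroup (op2 mul) (op2 ldiv) (op2 rdiv)].

Definition Lo (A B : Type) (k : nat) (F : set (B -> A)) : set (B -> A) :=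
  [set f | forall S : set B, (S #<= `I_k)%card ->
             exists2 g, F g & {in S, g =1 f}].

(* Main.v *)
Require Import Defs.
From mathcomp Require Import all_boot.
From mathcomp Require Import boolp classical_sets functions cardinality.

(** Since [A] and [A^m] are countable, [A^(A^m)] is a Polish space in which
    [F = C^[m]] is a countable subset, closed by hypothesis; by Baire, [F] has
    an isolated point: otherwise a diagonal argument yields a new limit point.  For [g, h] in [F],
    the translation [x |-> (g / h) x] is injective, maps [F] into [F] and [h]
    to [g], so isolation at one point becomes uniform: there is a finite [S]
    such that members of [F] that agree on [S] are equal.  Then
    [n = #|S| + 1] works: the member [g] of [F] that agrees with
    [f \in Lo_n F] on [S] must also agree with it on every [S `|` [set b]]. *)

Local Open Scope classical_set_scope.

Lemma countable_tuple {A : Type} (m : nat) :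
  countable [set: A] -> countable [set: m.-tuple A].
Proof.
move=> /countable_injP[f f_inj]; apply/countable_injP.
exists (fun t => pickle (map_tuple f t)).
move=> s t _ _ /(pcan_inj pickleK) /(congr1 (fun u => tnth u)) st.
apply: eq_from_tnth => i; apply: f_inj; rewrite ?in_setT //.
by have := congr1 (@^~ i) st; rewrite !tnth_map.
Qed.

Lemma card_le_setU1 {T : Type} (S : set T) (n : nat) (b : T) :
  (S #<= `I_n)%card -> (S `|` [set b] #<= `I_n.+1)%card.
Proof.
move=> /pfcard_geP[-> | [s]].
  rewrite set0U; apply: card_le_trans (card_image_le (fun=> b) `I_n.+1).
  by apply: subset_card_le => _ ->; exists 0.
(* The index [n], outside the domain of the surjection [s], is sent to the new point [b]. *)
apply: card_le_trans (card_image_le (fun i => if i < n then s i else b) `I_n.+1).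
apply: subset_card_le => x [Sx | ->]; last by exists n; rewrite /= ?ltnn.
have [i /= i_n <-] := @surj _ _ _ _ s _ Sx.
by exists i; rewrite ?i_n //=; apply: ltnW.
Qed.

Lemma Lo_superset {A B : Type} (k : nat) (F : set (B -> A)) : F `<=` Lo k F.
Proof. by move=> f Ff S _; exists f. Qed.

(** With [A] discrete, the intersection of all [Lo k F] is the closure of [F] in the product
    topology; this puts limits of members of [F] into it. *)
Lemma bigcap_Lo {A B : Type} (F : set (B -> A)) (f : B -> A) :
  (forall S, finite_set S -> exists2 g, F g & forall b, S b -> g b = f b) ->
  (\bigcap_k Lo k F) f.
Proof.
move=> F_f k _ S /card_le_finite/(_ (finite_II _)) /F_f[g Fg gf].
by exists g => // b /set_mem/gf.
Qed.

Lemma countable_bigcap_Lo_isolated {A B : Type} (F : set (B -> A)) :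
  countable [set: B] -> countable F -> F !=set0 -> \bigcap_k Lo k F = F ->
  exists (g : B -> A) (S : set B), [/\ F g, finite_set S
    & forall h, F h -> (forall b, S b -> h b = g b) -> h = g].
Proof.
move=> /countable_injP[eB eB_inj] /countable_injP[eF eF_inj] [g0 Fg0] F_closed.
apply: contrapT => no_isolated.
pose state := {p : (B -> A) * set B | F p.1 /\ finite_set p.2}.
(* [q] refines the finite approximation [p] so as to exclude the member of [F]
   of index [k] from all further refinements. *)
pose refines (kp : nat * state) (q : state) :=
  let: (k, p) := kp in
  [/\ forall b, (sval p).2 b -> (sval q).1 b = (sval p).1 b,
      (sval p).2 `<=` (sval q).2,
      forall b, eB b = k -> (sval q).2 b
    & forall e, F e -> eF e = k ->
        exists2 b, (sval q).2 b & (sval q).1 b <> e b].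
have [next nextP] : {next & forall kp, refines kp (next kp)}.
  apply: choice => -[k [[g S] [/= Fg S_fin]]].
  have fin_k : finite_set [set b | eB b = k].
    apply: (finite_preimage (B := [set k]) (f := eB)).
      by move=> b c _ _; apply: eB_inj; rewrite in_setT.
    exact: finite_set1.
  (* If [g] does not have code [k], it serves as [h]; otherwise [g] is not isolated by [S], which
     supplies another member of [F]. *)
  have [h [Fh hS h_e]] : exists h, [/\ F h, forall b, S b -> h b = g b
      & forall e, F e -> eF e = k -> h <> e].
    have [gk|gk] := eqVneq (eF g) k; last first.
      by exists g; split=> // e _ ek ge; rewrite ge ek eqxx in gk.
    apply: contrapT => no_h; apply: no_isolated.
    exists g, S; split=> // h Fh hS; apply: contrapT => h_g.
    apply: no_h; exists h; split=> // e Fe ek he; apply: h_g; rewrite he.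
    by apply: eF_inj; rewrite ?ek ?gk //; apply: mem_set.
  (* At most one [e] in [F] has code [k], so a single point where [h] and [e] differ suffices. *)
  have [w w_fin wP] : exists2 w : set B, finite_set w &
      forall e, F e -> eF e = k -> exists2 b, w b & h b <> e b.
    have [[e [Fe ek]]|no_e] := pselect (exists e, F e /\ eF e = k); last first.
      by exists set0 => // e Fe ek; case: no_e; exists e.
    have [b hb] : exists b, h b <> e b.
      apply: contrapT => he; apply: (h_e e) => //; apply: funext => b.
      by apply: contrapT => hb; apply: he; exists b.
    exists [set b]; first exact: finite_set1.
    move=> e' Fe' e'k; exists b => //.
    by rewrite (eF_inj e' e) ?ek ?e'k //; apply: mem_set.
  have fin : finite_set (S `|` [set b | eB b = k] `|` w).
    by rewrite !finite_setU.
  exists (exist _ (h, S `|` [set b | eB b = k] `|` w) (conj Fh fin)).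
  split=> //=.
  - by move=> b Sb; left; left.
  - by move=> b bk; left; right.
  - by move=> e Fe /(wP _ Fe)[b wb hb]; exists b => //; right.
pose s := fix s k : state := if k is k'.+1 then next (k', s k')
  else exist _ (g0, set0) (conj Fg0 (finite_set0 B)).
pose g k := (sval (s k)).1; pose S k := (sval (s k)).2.
have sP k : refines (k, s k) (s k.+1) by exact: nextP.
have S_mono j k : j <= k -> S j `<=` S k.
  elim: k => [|k IH]; first by rewrite leqn0 => /eqP->.
  rewrite leq_eqVlt => /predU1P[-> //|/IH Sjk].
  by apply: subset_trans Sjk _; have [] := sP k.
have g_stable j k b : j <= k -> S j b -> g k b = g j b.
  elim: k => [|k IH]; first by rewrite leqn0 => /eqP->.
  rewrite leq_eqVlt => /predU1P[-> //|jk Sb]; rewrite -IH //.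
  by have [+ _ _ _] := sP k; apply; apply: S_mono Sb.
(* Stage [eB b] puts [b] into the finite set, and values there never change afterwards, so [f] is
   the pointwise limit of the [g k]. *)
pose f b := g (eB b).+1 b.
have S_cover b : S (eB b).+1 b by have [_ _ + _] := sP (eB b); apply.
have f_eq k b : S k b -> f b = g k b.
  move=> Sb; have [le|/ltnW le] := leqP k (eB b).+1; first exact: g_stable.
  by rewrite [RHS](g_stable _ _ _ le).
have Ff : F f.
  rewrite -F_closed; apply: bigcap_Lo => T T_fin.
  (* The codes of points of a finite [T] are bounded, so a single stage covers [T]. *)
  have [k Tk] : exists k, T `<=` S k.
    have /finite_seqP[r rT] := finite_image eB T_fin.
    exists (\max_(i <- r) i).+1 => b Tb; apply: S_mono (S_cover b).
    rewrite ltnS; apply: (leq_bigmax_seq (F := id)) => //.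
    have : (eB @` T) (eB b) by exists b.
    by rewrite rT.
  exists (g k); first by case: (svalP (s k)).
  by move=> b /Tk/f_eq->.
(* Diagonal step: stage [eF f] made [g (eF f).+1] differ from [f] at a point of [S (eF f).+1], where
   the two agree. *)
have [_ _ _ /(_ f Ff erefl)[b Sb]] := sP (eF f).
by rewrite (f_eq (eF f).+1).
Qed.

(** On [S], [(g / u) v = (g / u) u = g], so isolation gives [(g / u) v = g] everywhere; left
    division by [g / u] then recovers both [u] and [v] from [g]. *)
Lemma eq_on_of_isolated {A B : Type} (F : set (B -> A)) (mul ldiv rdiv : A -> A -> A)
    (g : B -> A) (S : set B) :
  is_quasigroup mul ldiv rdiv ->
  (forall u v, F u -> F v -> F (fun b => mul (u b) (v b))) ->
  (forall u v, F u -> F v -> F (fun b => rdiv (u b) (v b))) ->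
  F g -> (forall h, F h -> (forall b, S b -> h b = g b) -> h = g) ->
  forall u v, F u -> F v -> (forall b, S b -> u b = v b) -> u = v.
Proof.
move=> [_ mulK rdivK _] F_mul F_rdiv Fg g_iso u v Fu Fv uv.
have h_g : (fun b => mul (rdiv (g b) (u b)) (v b)) = g.
  by apply: g_iso => [|b Sb]; rewrite -?uv //; apply/F_mul => //; apply: F_rdiv.
apply: funext => b; rewrite -[RHS](mulK (rdiv (g b) (u b))).
by rewrite (congr1 (@^~ b) h_g) -{2}(rdivK (u b) (g b)) mulK.
Qed.

Lemma Lo_stable_of_determining {A B : Type} (F : set (B -> A)) (S : set B) (n : nat) :
  (S #<= `I_n)%card ->
  (forall u v, F u -> F v -> (forall b, S b -> u b = v b) -> u = v) ->
  Lo n.+1 F = F.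
Proof.
move=> S_n S_det; rewrite eqEsubset; split; last exact: Lo_superset.
move=> f Lof.
have ext b : exists2 g, F g & forall c, (S `|` [set b]) c -> g c = f c.
  have [g Fg gf] := Lof _ (card_le_setU1 _ _ b S_n).
  by exists g => // c /mem_set/gf.
have [g Fg gf] : exists2 g, F g & {in S, g =1 f}.
  apply: Lof; apply: card_le_trans S_n _.
  by apply: subset_card_le => i /= /ltnW.
rewrite (_ : f = g) //; apply: funext => b; have [h Fh hf] := ext b.
rewrite -(hf b); last by right.
congr (_ b); apply: S_det => // c Sc.
by rewrite hf ?gf //; [exact: mem_set|left].
Qed.

Lemma clone_op2 {A : Type} (C : forall n : nat, set (operation A n)) (m : nat)
    (p : operation A 2) (u v : operation A m) :
  is_clone C -> C 2 p -> C m u -> C m v -> C m (fun t => op2 p (u t) (v t)).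
Proof.
move=> [_ C_comp] Cp Cu Cv.
pose w (i : 'I_2) := if i == ord0 then u else v.
rewrite (_ : (fun t => _) = comp_op p w); last first.
  apply: funext => t; congr p; apply: val_inj => /=.
  by rewrite !enum_ordSl enum_ord0.
by apply: C_comp => // i; rewrite /w; case: ifP.
Qed.

Theorem theorem3p2 (A : Type) (m : nat) (C : forall n : nat, set (operation A n))
    (A_countable : countable [set: A])
    (C_clone : is_clone C)
    (C_quasigroup : has_quasigroup_operations C)
    (Cm_countable : countable (C m)) :
  \bigcap_k Lo k (C m) = C m ->
  exists n : nat, Lo n (C m) = C m.
Proof.
move=> Cm_closed; have [mul [ldiv [rdiv [Cmul _ Crdiv quasi]]]] := C_quasigroup.
have [Cm0|/set0P/(countable_bigcap_Lo_isolated _ (countable_tuple m A_countable)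
    Cm_countable)/(_ Cm_closed)[g [S [Cg [n S_n] g_iso]]]] := eqVneq (C m) set0.
  (* For empty [C m], already [Lo 0] is empty: even the empty test set demands a member of [C m]. *)
  exists 0; rewrite eqEsubset; split; last exact: Lo_superset.
  by move=> f /(_ set0 (card_ge0 _ _))[g + _]; rewrite Cm0.
exists n.+1; apply: (@Lo_stable_of_determining _ _ _ S).
  by move: S_n; rewrite card_eq_le => /andP[].
apply: eq_on_of_isolated quasi _ _ Cg g_iso => u v Cu Cv.
- exact: clone_op2 C_clone Cmul Cu Cv.
- exact: clone_op2 C_clone Crdiv Cu Cv.
Qed.
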